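(* For every integer $n\ge 5$, $\mathrm{HG_{lin}}(C_n)\le 2$, where $C_n$ is the (undirected) cycle on $n$ vertices.
   Context: Let $G$ be a finite simple graph with vertices $v_1,\ldots,v_n$, let $q$ be a prime power, and let the set of colors be the finite field $\mathbb{F}_q$. A coloring is any $x\in\mathbb{F}_q^n$, where $x_i$ is the color of $v_i$. A linear guessing strategy over $\mathbb{F}_q$ is a choice, for each $i$, of an affine function $f_i(x)=\sum_{j\in N_i}a_{i,j}x_j+b_i$ with $a_{i,j},b_i\in\mathbb{F}_q$, where $N_i$ is the set of indices of the neighbors of $v_i$; vertex $v_i$ guesses correctly on $x$ if $f_i(x)=x_i$. $G$ is linearly $q$-solvable if there is a linear guessing strategy over $\mathbb{F}_q$ such that for every $x\in\mathbb{F}_q^n$ at least one vertex guesses correctly. The linear hat guessing number $\mathrm{HG_{lin}}(G)$ is the largest prime power $q$ for which $G$ is linearly $q$-solvable. *)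

(* Defs.v *)
From mathcomp Require Import all_boot all_order all_algebra.
From mathcomp Require Import boolp.

Set Implicit Arguments.
Unset Strict Implicit.
Unset Printing Implicit Defensive.

Import GRing.Theory.
Local Open Scope ring_scope.

Record sgraph := SGraph {
  vertex :> finType;
  adj : rel vertex;
  adj_sym : symmetric adj;
  adj_irrefl : irreflexive adj }.

Definition coloring (G : sgraph) (F : finFieldType) := {ffun G -> F}.

(* [coef s i j] is only used when [i] and [j] are adjacent, see [guess]. *)
Record linear_strategy (G : sgraph) (F : finFieldType) := LinearStrategy {
  coef : G -> G -> F;
  const : G -> F }.

Definition guess (G : sgraph) (F : finFieldType) (s : linear_strategy G F)
    (i : G) (x : coloring G F) : F :=
  \sum_(j | adj i j) coef s i j * x j + const s i.

(* The orders of finite fields are exactly the prime powers, and any two finite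
   fields of order [q] are isomorphic, so this covers exactly the prime powers
   [q], and the choice of a model [F] of the field with [q] elements is
   irrelevant. *)
Definition linearly_solvable (G : sgraph) (q : nat) : Prop :=
  exists2 F : finFieldType, #|F| = q &
    exists s : linear_strategy G F,
      forall x : coloring G F, exists i : G, guess s i x = x i.

Lemma linearly_solvable_le_card (G : sgraph) (q : nat) :
  linearly_solvable G q -> (q <= #|G|)%N.
Proof.
case=> F <- [s Hs].
pose A (i : G) : {set coloring G F} := [set x | guess s i x == x i].
pose upd (i : G) (x : coloring G F) (c : F) : coloring G F :=
  [ffun j => if j == i then c else x j].
have guess_eq i (x y : coloring G F) :
    (forall j, j != i -> x j = y j) -> guess s i x = guess s i y.
  move=> xy; congr (_ + _); apply: eq_bigr => j ij; rewrite xy //.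
  by apply/eqP => ji; rewrite ji adj_irrefl in ij.
have cardA i : (#|A i| * #|F| <= #|{: coloring G F}|)%N.
  rewrite -cardsT -cardsX.
  rewrite -(@card_in_imset _ _ (fun p => upd i p.1 p.2)) ?max_card //.
  move=> [x c] [y d]; rewrite !inE /= !andbT => /eqP Ax /eqP Ay /ffunP E.
  have xy j : j != i -> x j = y j by move=> ji; have := E j; rewrite !ffunE (negPf ji).
  congr (_, _); last by have := E i; rewrite !ffunE eqxx.
  apply/ffunP => j; have [->|/xy//] := eqVneq j i.
  by rewrite -Ax -Ay (guess_eq _ _ _ xy).
have cov : (#|{: coloring G F}| <= \sum_(i : G) #|A i|)%N.
  under eq_bigr do rewrite -sum1_card.
  rewrite (exchange_big_dep predT) //= -sum1_card leq_sum // => x _.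
  by case: (Hs x) => i xi; rewrite (bigD1 i) // inE xi.
have all_gt0 : (0 < #|{: coloring G F}|)%N by apply/card_gt0P; exists [ffun=> 0].
rewrite -(leq_pmul2l all_gt0) [leqRHS]mulnC.
apply: leq_trans (leq_mul cov (leqnn _)) _; rewrite big_distrl /=.
by apply: leq_trans (leq_sum _ (fun i _ => cardA i)) _; rewrite sum_nat_const.
Qed.

Lemma linearly_solvable2 (G : sgraph) (u v : G) :
  adj u v -> linearly_solvable G 2.
Proof.
move=> uv; exists 'F_2; first by rewrite card_Fp.
pose e (i : G) : G := if i == u then v else u.
exists (LinearStrategy (fun i j => (j == e i)%:R) (fun i => (i == v)%:R)) => x.
have uvF : u != v by apply/eqP => E; rewrite E adj_irrefl in uv.
have guessE i : adj i (e i) ->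
    guess (LinearStrategy (fun i j => (j == e i)%:R) (fun i => (i == v)%:R)) i x
    = x (e i) + (i == v)%:R.
  move=> ie; rewrite /guess /= (bigD1 (e i)) //= eqxx mul1r big1 ?addr0 //.
  by move=> j /andP[_ /negPf->]; rewrite mul0r.
have [E|NE] := eqVneq (x u) (x v).
  by exists u; rewrite guessE /e eqxx // (negPf uvF) addr0.
exists v; rewrite guessE /e eq_sym (negPf uvF) 1?adj_sym // eqxx.
by move: (x u) (x v) NE => [[|[|?]] ?] [[|[|?]] ?] // _; apply/val_inj.
Qed.

(* The largest [q] such that [G] is linearly [q]-solvable: bounding [q] by the
   number of vertices loses nothing, by [linearly_solvable_le_card]. If no such
   [q] exists, i.e. if [G] has no edge, the value is 0. *)
Definition HGlin (G : sgraph) : nat :=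
  \max_(q < #|G|.+1 | `[< linearly_solvable G q >]) q.

Lemma HGlin_ub (G : sgraph) (q : nat) :
  linearly_solvable G q -> (q <= HGlin G)%N.
Proof.
move=> sq; have lt_q : (q < #|G|.+1)%N by rewrite ltnS linearly_solvable_le_card.
exact/(leq_bigmax_cond (Ordinal lt_q))/asboolP.
Qed.

Lemma HGlin_solvable (G : sgraph) (u v : G) :
  adj u v -> linearly_solvable G (HGlin G).
Proof.
move=> /linearly_solvable2 s2.
have lt_2 : (2 < #|G|.+1)%N by rewrite ltnS linearly_solvable_le_card.
rewrite /HGlin (bigmax_eq_arg (Ordinal lt_2)); last exact/asboolP.
by case: arg_maxnP => [|q /asboolP //]; apply/asboolP.
Qed.

(* Vertices [i] and [j] are adjacent iff [j = i + 1] or [i = j + 1] modulo [n].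
   The condition [i != j] only matters for [n = 1]. *)
Definition cycle_adj (n : nat) : rel 'I_n :=
  fun i j => (i != j) && ((ordS i == j) || (ordS j == i)).

Lemma cycle_adj_sym (n : nat) : symmetric (@cycle_adj n).
Proof. by move=> i j; rewrite /cycle_adj eq_sym orbC. Qed.

Lemma cycle_adj_irrefl (n : nat) : irreflexive (@cycle_adj n).
Proof. by move=> i; rewrite /cycle_adj eqxx. Qed.

Definition cycle_graph (n : nat) : sgraph :=
  SGraph (@cycle_adj_sym n) (@cycle_adj_irrefl n).

(* Main.v *)
Require Import Defs.
From mathcomp Require Import all_boot.
From mathcomp Require Import all_order all_algebra boolp ring.

(** Let F be a field with at least 3 elements and n >= 5. Vertex i of the cycle
guesses right on x exactly when the affine form
a_i x_(i-1) - x_i + c_i x_(i+1) + b_i vanishes, so one has to find x at which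
none of these n forms vanishes. The only fact used about the size of F is that a
colour can always avoid two given values; colours are therefore chosen one after the other
so that each choice has to satisfy at most two constraints.

Going around the cycle, the form of vertex k is taken care of when x_(k+1) is
chosen (if c_k <> 0) or already when x_k is chosen (if c_k = 0). Trouble can
only come from closing the cycle. There are two cases.

- Some vertex ignores one of its two neighbours. By rotation and reflection it
  is vertex 0 ignoring vertex n - 1. Then the last colour x_(n-1) only meets the
  forms of n - 2 and n - 1, and the greedy choice succeeds
  ([beatable_missing_arc]).

- All a_i and c_i are nonzero. The colours x_0, ..., x_(n-4) are chosen
  greedily, and three consecutive vertices with colours p, q, r remain. They
  meet five forms: the form of vertex n - 4 forbids one value of p, that of
  vertex 0 forbids one value of r, and those of the three vertices themselves
  each forbid at most one value of q, which is one too many in general. But the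
  value of q forbidden by the first of the three vertices is a bijective function
  of p, and the one forbidden by the third is a bijective function of r.
  Choosing r as the function of p that makes these two values equal leaves two
  constraints on p, then two on q ([beatable_all_arcs]). The outer neighbours of
  the three vertices must be distinct, whence n >= 5. *)

Set Implicit Arguments.
Unset Strict Implicit.
Unset Printing Implicit Defensive.

Import GRing.Theory.

Section Avoidance.

Local Open Scope ring_scope.

Variable F : finFieldType.
Hypothesis card_gt2 : (2 < #|F|)%N.

Lemma avoid2 (s t : F) : exists v : F, (v != s) && (v != t).
Proof.
have /card_gt0P[v] : (0 < #|~: [set s; t]|)%N.
  by rewrite cardsCs setCK subn_gt0 cards2 (leq_ltn_trans _ card_gt2) ?ltnS ?leq_b1.
by rewrite !inE negb_or => ?; exists v.
Qed.

(** In [B1] and [B2] the first colour argument is the one chosen two steps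
before; for the very first choice there is none, and [k.-1] repeats [y0]. *)
Lemma greedy_seq (y0 : F) (B1 B2 : nat -> F -> F -> F) :
  exists y : nat -> F, y 0 = y0 /\
    forall k, y k.+1 != B1 k (y k.-1) (y k) /\ y k.+1 != B2 k (y k.-1) (y k).
Proof.
pose pickv s t := xchoose (avoid2 s t).
pose step k (w : F * F) := (w.2, pickv (B1 k w.1 w.2) (B2 k w.1 w.2)).
pose w k := iteri k step (y0, y0).
have w1 k : (w k).1 = (w k.-1).2 by case: k.
exists (fun k => (w k).2); split=> // k; rewrite -w1.
exact/andP/(xchooseP (avoid2 (B1 k (w k).1 (w k).2) (B2 k (w k).1 (w k).2))).
Qed.

Lemma neq_root (c e v : F) : c != 0 -> v != - e / c -> e + c * v != 0.
Proof.
move=> c0; apply: contraNN => /eqP E; rewrite eq_sym -subr_eq0; apply/eqP.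
have -> : - e / c - v = - (e + c * v) / c by field.
by rewrite E oppr0 mul0r.
Qed.

(** The guess of vertex [i] minus its colour: vertex [i] errs when this is
nonzero. *)
Definition miss (m : nat) (a b c x : 'I_m.+2 -> F) (i : 'I_m.+2) : F :=
  a i * x (i - 1) - x i + c i * x (i + 1) + b i.

(** The strategy with coefficients [a], [c] and constants [b] fails to win. *)
Definition beatable (m : nat) (a b c : 'I_m.+2 -> F) :=
  exists x, forall i, miss a b c x i != 0.

Lemma beatable_rotate (m : nat) (a b c : 'I_m.+2 -> F) (t : 'I_m.+2) :
  beatable (fun i => a (i + t)) (fun i => b (i + t)) (fun i => c (i + t)) ->
  beatable a b c.
Proof.
case=> x Hx; exists (fun i => x (i - t)) => i.
by have := Hx (i - t); rewrite /miss subrK [i - t - 1]addrAC [i - t + 1]addrAC.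
Qed.

Lemma beatable_reflect (m : nat) (a b c : 'I_m.+2 -> F) :
  beatable (fun i => c (- i)) (fun i => b (- i)) (fun i => a (- i)) ->
  beatable a b c.
Proof.
case=> x Hx; exists (fun i => x (- i)) => i.
have := Hx (- i); rewrite /miss opprK opprB opprD [- i + 1]addrC.
by have -> : forall u v w z : F, u - v + w + z = w - v + u + z by move=> *; ring.
Qed.

(** Taking [miss] at [k.+1] rather than [k] avoids predecessors of natural
numbers. *)
Definition nat_miss (A B C y : nat -> F) (k : nat) : F :=
  A k.+1 * y k - y k.+1 + C k.+1 * y k.+2 + B k.+1.

(** Cutting the cycle between [m.+1] and [0] replaces modular indices by natural
numbers; only the forms of these two vertices wrap around. *)
Lemma beatable_seq (m : nat) (a b c : 'I_m.+2 -> F) (y : nat -> F)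
    (A := fun k => a (inord k)) (B := fun k => b (inord k))
    (C := fun k => c (inord k)) :
  A 0%N * y m.+1 - y 0%N + C 0%N * y 1%N + B 0%N != 0 ->
  A m.+1 * y m - y m.+1 + C m.+1 * y 0%N + B m.+1 != 0 ->
  (forall k, (k < m)%N -> nat_miss A B C y k != 0) ->
  beatable a b c.
Proof.
move=> first last mid; exists (fun i => y (val i)) => i.
rewrite -[i]inord_val /miss; case: (val i) (ltn_ord i) => [_|k].
  have e : (inord 0 : 'I_m.+2) = 0 by apply/val_inj; rewrite /= inordK.
  rewrite e; rewrite /A /B /C e in first; move: first.
  by rewrite sub0r add0r /= /Zp_opp /= !modn_small.
rewrite !ltnS => lekm.
have predE : val (inord k.+1 - 1 : 'I_m.+2) = k.
  have -> : (inord k.+1 : 'I_m.+2) = inord k + 1.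
    by apply/val_inj; rewrite /= !inordK ?ltnS ?leqW // addn1 modn_small.
  by rewrite addrK /= inordK // ltnS leqW.
rewrite predE [\val (inord _)]inordK //; move: lekm.
rewrite leq_eqVlt => /orP[/eqP->|ltkm].
  have -> : (inord m.+1 : 'I_m.+2) + 1 = 0.
    by apply/val_inj; rewrite /= inordK //= addn1 modnn.
  exact: last.
have -> : val (inord k.+1 + 1 : 'I_m.+2) = k.+2.
  by rewrite /= inordK ?ltnS 1?ltnW //= addn1 modn_small // !ltnS.
exact: mid.
Qed.

(** Greedy choice in the order 0, 1, ...: as vertex 0 ignores the last vertex,
choosing the last colour involves only the last two forms. *)
Lemma beatable_missing_arc (m : nat) (a b c : 'I_m.+2 -> F) :
  a 0 = 0 -> beatable a b c.
Proof.
move=> a0.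
pose A k := a (inord k); pose B k := b (inord k); pose C k := c (inord k).
have A0 : A 0%N = 0.
  by rewrite /A -[RHS]a0; congr a; apply/val_inj; rewrite /= inordK.
(* [B1 k] is the value of the next colour at which the form of [k] vanishes, when
   that form sees it; [B2 k] is the one at which the form of [k.+1] vanishes,
   when that form sees no unchosen colour (for [k = m], the colour after the
   last vertex is that of vertex 0). The colour [B 0 + 1] of vertex 0 makes it
   err if it also ignores vertex 1. *)
pose B1 k p u := - (A k * p - u + B k) / C k.
pose B2 k (p u : F) :=
  A k.+1 * u + B k.+1 + (if k == m then C k.+1 * (B 0%N + 1) else 0).
have [y [y0 Hy]] := greedy_seq (B 0%N + 1) B1 B2.
have early k : C k != 0 -> A k * y k.-1 - y k + C k * y k.+1 + B k != 0.
  move=> Ck; rewrite addrAC; apply: neq_root => //; exact: (Hy k).1.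
have late k : y k.+1 != A k.+1 * y k + B k.+1 + (if k == m then C k.+1 * y 0%N else 0).
  by rewrite y0; apply: (Hy k).2.
apply: (beatable_seq (y := y)).
- rewrite -/(A 0%N) -/(B 0%N) -/(C 0%N).
  have [C0|C0] := eqVneq (C 0%N) 0; last first.
    by have := early 0%N C0; rewrite A0 !mul0r.
  rewrite A0 C0 !mul0r y0 addr0 sub0r opprD addrAC addNr add0r.
  by rewrite oppr_eq0 oner_eq0.
- rewrite -/(A m.+1) -/(B m.+1) -/(C m.+1).
  apply: contraNN (late m) => /eqP E; rewrite eqxx eq_sym -subr_eq0 -[X in _ == X]E.
  by apply/eqP; ring.
move=> k ltkm; rewrite /nat_miss -/(A k.+1) -/(B k.+1) -/(C k.+1).
have [Ck|Ck] := eqVneq (C k.+1) 0; last exact: early k.+1 Ck.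
apply: contraNN (late k) => /eqP E; rewrite (ltn_eqF ltkm) eq_sym -subr_eq0.
by rewrite -[X in _ == X]E Ck; apply/eqP; ring.
Qed.

(** The last three colours are [p], [q] and [rho p], where [rho] makes the
vertices of [p] and [rho p] forbid the same value [mu p] of [q]. *)
Lemma beatable_all_arcs (m : nat) (a b c : 'I_m.+2 -> F) : (2 < m)%N ->
  (forall i, a i != 0) -> (forall i, c i != 0) -> beatable a b c.
Proof.
case: m a b c => [|[|[|m]]] // a b c _ a_neq0 c_neq0.
pose A k := a (inord k); pose B k := b (inord k); pose C k := c (inord k).
have A_neq0 k : A k != 0 by apply: a_neq0.
have C_neq0 k : C k != 0 by apply: c_neq0.
pose B1 k p u := - (A k * p - u + B k) / C k.
have [y [_ Hy]] := greedy_seq 0 B1 B1.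
have early k : A k * y k.-1 - y k + C k * y k.+1 + B k != 0.
  rewrite addrAC; apply: neq_root => //; exact: (Hy k).1.
pose mu p := (p - A m.+2 * y m.+1 - B m.+2) / C m.+2.
pose rho p := A m.+4 * mu p + C m.+4 * y 0%N + B m.+4.
(* [s] is the value of [p] forbidden by the vertex before it; [r'] is the last
   colour forbidden by vertex 0, and [p'] its preimage under [rho]. *)
pose s := B1 m.+1 (y m) (y m.+1).
pose r' := (- (- y 0%N + C 0%N * y 1%N + B 0%N)) / A 0%N.
pose p' := C m.+2 * (r' - C m.+4 * y 0%N - B m.+4) / A m.+4 + A m.+2 * y m.+1 + B m.+2.
have [p /andP[ps pp']] := avoid2 s p'.
have [q /andP[q1 q2]] := avoid2 (mu p) (A m.+3 * p + C m.+3 * rho p + B m.+3).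
pose z k := if (k < m.+2)%N then y k else
  if k == m.+2 then p else if k == m.+3 then q else rho p.
have zE k : (k < m.+2)%N -> z k = y k by rewrite /z => ->.
have zp : z m.+2 = p by rewrite /z ltnn eqxx.
have zq : z m.+3 = q by rewrite /z ltnNge leqnSn /= eqxx gtn_eqF.
have zr : z m.+4 = rho p by rewrite /z ltnNge ltnW //= !gtn_eqF.
apply: (beatable_seq (y := z)).
- rewrite zr !zE // -/(A 0%N) -/(B 0%N) -/(C 0%N).
  apply: contraNN pp' => /eqP E.
  have r'E : r' = rho p.
    apply: (mulIf (A_neq0 0%N)); rewrite divfK //.
    by apply/eqP; rewrite -subr_eq0 -oppr_eq0 -[X in _ == X]E; apply/eqP; ring.
  by apply/eqP; rewrite /p' r'E /rho /mu; field; rewrite A_neq0 C_neq0.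
- rewrite zr zq zE // -/(A m.+4) -/(B m.+4) -/(C m.+4).
  have -> : A m.+4 * q - rho p + C m.+4 * y 0%N + B m.+4 = A m.+4 * (q - mu p).
    by rewrite /rho; ring.
  by rewrite mulf_neq0 // subr_eq0.
move=> k; rewrite /nat_miss -/(A k.+1) -/(B k.+1) -/(C k.+1).
rewrite ltnS leq_eqVlt => /orP[/eqP->|]; last rewrite ltnS leq_eqVlt => /orP[/eqP->|].
- rewrite zp zq zr; apply: contraNN q2 => /eqP E.
  by rewrite eq_sym -subr_eq0 -[X in _ == X]E; apply/eqP; ring.
- rewrite zE // zp zq.
  have -> : A m.+2 * y m.+1 - p + C m.+2 * q + B m.+2 = C m.+2 * (q - mu p).
    by rewrite /mu; field; rewrite C_neq0.
  by rewrite mulf_neq0 // subr_eq0.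
rewrite ltnS leq_eqVlt => /orP[/eqP->|ltkm].
- by rewrite zp !zE // addrAC; apply: neq_root.
by rewrite !zE ?ltnS ?(leqW (ltnW ltkm)) ?(ltnW ltkm) //; apply: early k.+1.
Qed.

Lemma beatable_cycle (m : nat) (a b c : 'I_m.+2 -> F) :
  (2 < m)%N -> beatable a b c.
Proof.
move=> m_gt2.
have [/existsP[t /eqP at0]|/existsPn a_neq0] := boolP [exists t, a t == 0].
  by apply: (beatable_rotate (t := t)); apply: beatable_missing_arc; rewrite add0r.
have [/existsP[t /eqP ct0]|/existsPn c_neq0] := boolP [exists t, c t == 0].
  apply: (beatable_rotate (t := t)); apply: beatable_reflect.
  by apply: beatable_missing_arc; rewrite oppr0 add0r.
exact: beatable_all_arcs.
Qed.

(** With at least three vertices, the two neighbours of [i] are distinct from each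
other and from [i], so each contributes one term. *)
Lemma guess_cycle (m : nat) (s : linear_strategy (cycle_graph m.+3) F)
    (i : 'I_m.+3) (x : coloring (cycle_graph m.+3) F) :
  guess s i x = coef s i (i - 1) * x (i - 1) + coef s i (i + 1) * x (i + 1)
                + const s i.
Proof.
have ordS1 (j : 'I_m.+3) : ordS j = j + 1.
  by apply/val_inj; rewrite /= modnDmr addn1.
have adjE j : adj (s := cycle_graph m.+3) i j = (j == i - 1) || (j == i + 1).
  rewrite /= /cycle_adj !ordS1 -[j + 1 == i](inj_eq (subIr 1)) addrK.
  rewrite [i + 1 == j]eq_sym orbC andb_idl // => /orP[]/eqP->.
    by rewrite -[X in X != _]addr0 (inj_eq (addrI i)) eq_sym oppr_eq0 oner_eq0.
  by rewrite -[X in X != _]addr0 (inj_eq (addrI i)) eq_sym oner_eq0.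
have ne : i + 1 != i - 1 by rewrite (inj_eq (addrI i)) -val_eqE /= !modn_small ?subn1.
rewrite /guess (eq_bigl _ _ adjE) (bigD1 (i - 1)) ?eqxx //=; congr (_ + _ + _).
rewrite (big_pred1 (i + 1)) // => j /=.
by have [->|jm] := eqVneq j (i - 1); rewrite ?andbT ?andbF // eq_sym (negPf ne).
Qed.

End Avoidance.

Theorem theorem1p10 (n : nat) (hn : 5 <= n) : HGlin (cycle_graph n) <= 2.
Proof.
apply/bigmax_leqP => q /asboolP[F <- [s Hs]].
rewrite leqNgt; apply/negP => card_gt2.
case: n hn s Hs {q} => [|[|[|m]]] // hn s Hs.
have [x Hx] := beatable_cycle card_gt2 (fun i : 'I_m.+3 => coef s i (i - 1)%R)
  (const s) (fun i => coef s i (i + 1)%R) hn.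
have [i] := Hs [ffun j => x j].
rewrite guess_cycle !ffunE => E; have /eqP := Hx i; apply.
by rewrite /miss -E; ring.
Qed.
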